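(* For every fixed integer $p\ge 2$, $\lambda_s(n,p)=\Theta\big(n^{1/(p-1)}\big)$ as $n\to\infty$. In particular, for every integer $n\ge p$, $$\frac{1}{e}\,n^{1/(p-1)}\;\le\;\lambda_s(n,p)\;\le\;2(p-1)\,n^{1/(p-1)},$$ where $\lambda_s(n,p)$ is the maximum negative girth among all signed graphs on $n$ vertices whose balanced chromatic number is at least $p$, and $e$ is the base of the natural logarithm.
   Context: A signed graph $\widehat{G}=(G,\sigma)$ is a finite graph $G$ together with a signature $\sigma:E(G)\to\{-,+\}$. Graphs have no loops; two vertices may be joined both by a positive and by a negative edge (such a pair of parallel edges is an unbalanced digon, and is a negative cycle of length 2). Switching a vertex $v$ means flipping the signs of all edges incident to $v$. A set $B\subseteq V(G)$ is balanced if the signature on the induced signed subgraph $\widehat{G}[B]$ can be made all positive by a series of switchings (equivalently, $\widehat{G}[B]$ contains no negative cycle). A balanced $p$-coloring of $\widehat{G}$ is a map $f:V(G)\to\{1,\dots,p\}$ such that $f^{-1}(i)$ is a balanced set for every $i$. The balanced chromatic number $\chi_b(\widehat{G})$ is the minimum $p$ such that $\widehat{G}$ admits a balanced $p$-coloring. A cycle is negative if the product of the signs of its edges is negative. The negative girth $g_-(\widehat{G})$ is the length of a shortest negative cycle in $\widehat{G}$. The quantity $\lambda_s(n,p)$ is the maximum of $g_-(\widehat{G})$ over all signed graphs $\widehat{G}$ on $n$ vertices with $\chi_b(\widehat{G})\ge p$. *)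

(* Defs.v *)
From HB Require Import structures.
From mathcomp Require Import all_boot all_order all_algebra.
From mathcomp Require Import all_classical all_reals all_analysis.
Set Implicit Arguments.
Unset Strict Implicit.
Unset Printing Implicit Defensive.
Import Order.TTheory GRing.Theory Num.Theory.
Import numFieldNormedType.Exports.

(* A signed edge is a pair (ends, sign).  The sign group {+, -} is (bool, addb),
   with false for + and true for -, so flipping is negb and the product of signs
   is iterated addb. *)
Notation sedge T := ({set T} * bool)%type.

(* There are no loops, and at most one edge of each sign between two vertices;
   both signs may be present (an unbalanced digon). *)
Record sgraph (T : finType) := SGraph {
  edges :> {set sedge T};
  edges_card2 : [forall e in edges, #|e.1| == 2] }.

HB.instance Definition _ (T : finType) := [isSub for @edges T].
HB.instance Definition _ (T : finType) := [Finite of sgraph T by <:].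

Definition flip_at (T : finType) (v : T) (e : sedge T) : sedge T :=
  (e.1, (v \in e.1) (+) e.2).

Lemma switch_card2 (T : finType) (v : T) (G : sgraph T) :
  [forall e in flip_at v @: G, #|e.1| == 2].
Proof.
apply/forall_inP => _ /imsetP[e eG ->].
exact: (forall_inP (edges_card2 G) e eG).
Qed.

Definition switch (T : finType) (v : T) (G : sgraph T) : sgraph T :=
  SGraph (switch_card2 v G).

Lemma induced_card2 (T : finType) (G : sgraph T) (B : {set T}) :
  [forall e in [set e in edges G | e.1 \subset B], #|e.1| == 2].
Proof.
apply/forall_inP => e; rewrite inE => /andP[eG _].
exact: (forall_inP (edges_card2 G) e eG).
Qed.

(* G[B], kept on the vertex type T: vertices outside B become isolated, which
   affects neither switching nor cycles. *)
Definition induced (T : finType) (G : sgraph T) (B : {set T}) : sgraph T :=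
  SGraph (induced_card2 G B).

Definition all_positive (T : finType) (G : sgraph T) : Prop :=
  forall e : sedge T, e \in edges G -> e.2 = false.

Definition balanced (T : finType) (G : sgraph T) (B : {set T}) : Prop :=
  exists s : seq T, all_positive (foldr (@switch T) (induced G B) s).

Definition balanced_coloring (T : finType) (G : sgraph T) (p : nat)
    (f : T -> 'I_p) : Prop :=
  forall i : 'I_p, balanced G [set v | f v == i].

Definition bcolorable (T : finType) (G : sgraph T) (p : nat) : bool :=
  `[< exists f : T -> 'I_p, balanced_coloring G f >].

Lemma bcolorable_card (T : finType) (G : sgraph T) : exists p, bcolorable G p.
Proof.
exists #|T|; apply/asboolP; exists enum_rank => i; exists [::] => e /=.
rewrite inE => /andP[eG /subset_leq_card].
rewrite (eqP (forall_inP (edges_card2 G) e eG)).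
suff -> : [set v | enum_rank v == i] = [set enum_val i] by rewrite cards1.
apply/setP => v; rewrite !inE; apply/eqP/eqP => [<-|->].
  by rewrite enum_rankK.
by rewrite enum_valK.
Qed.

Definition chi_b (T : finType) (G : sgraph T) : nat :=
  ex_minn (bcolorable_card G).

(* A closed walk [:: (x_0, s_0); ...; (x_(k-1), s_(k-1))] leaves x_i along an
   edge of sign s_i towards x_(i+1), indices being taken modulo k. *)
Definition walk_edges (T : finType) (c : seq (T * bool)) : seq (sedge T) :=
  [seq ([set d.1.1; d.2.1], d.1.2) | d <- zip c (rot 1 c)].

(* Distinctness of the edges only matters for k = 2, where it excludes going
   back and forth along a single edge. *)
Definition is_cycle (T : finType) (G : sgraph T) (c : seq (T * bool)) : bool :=
  [&& 2 <= size c, uniq (map fst c), uniq (walk_edges c)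
    & all (fun e => e \in edges G) (walk_edges c)].

Definition cycle_sign (T : finType) (c : seq (T * bool)) : bool :=
  \big[addb/false]_(e <- walk_edges c) e.2.

Definition has_neg_cycle (T : finType) (G : sgraph T) (k : nat) : bool :=
  [exists c : k.-tuple (T * bool), is_cycle G c && cycle_sign c].

(* The value 0 is a convention for signed graphs without negative cycle, i.e.
   those with chi_b G <= 1. *)
Definition neg_girth (T : finType) (G : sgraph T) : nat :=
  if pselect (exists k, has_neg_cycle G k) is left h then ex_minn h else 0.

Definition lambda_s (n p : nat) : nat :=
  \max_(G : sgraph 'I_n | p <= chi_b G) neg_girth G.

(* Main.v *)
Require Import Defs.
From HB Require Import structures.
From mathcomp Require Import all_boot all_order all_algebra zify.
From mathcomp Require Import all_classical all_reals all_analysis.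

(** Write d = p - 1.

Lower bound. Take a triangulated d-sphere with an antipodal symmetry, and let
the vertices of the signed graph be the pairs of antipodal points: an edge is
positive or negative according to whether it joins the chosen representatives,
or one representative to the antipode of the other. A negative cycle lifts to
a path between two antipodal points, so the negative girth is at least the
antipodal distance. A balanced coloring with q colors, together with the
switching functions of its classes, lifts to an antisymmetric labelling of the
sphere by q colors with signs in which no two adjacent points carry opposite
labels; a mod 2 count of alternating simplices, as in the lemmas of Tucker and
Fan, forces q > d ([antipodal_labelling_size]). The sphere used here is an
iterated suspension in which every suspension coordinate is subdivided into g
steps. Its antipodal distance is g ([touching_path_antipode]) and it has 1 +
(g-1) + ... + (g-1)^d antipodal pairs, which is at most (d+1)(g-1)^d <=
(e(g-1))^d. Hence n vertices suffice as soon as g - 1 <= n^(1/d)/e.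

Upper bound. Let t - 1 be the integer part of n^(1/d) and rho = d (t-1). If
the negative girth exceeds 2 rho - 1, then the graph has a balanced
d-coloring, so the negative girth is at most 2 rho <= 2 d n^(1/d) when p
colors are needed. Indeed a set of vertices contained in a ball of radius rho
- 1 is balanced, because two short walks from the center and one edge form a
closed walk of length at most 2 rho - 1 ([clustered_balanced]). So it suffices
to partition the vertices into d sets whose connected components all lie in
such balls. This is done by induction on d ([cluster_partition]), as in the
proof that small balls imply small Uryson width: choose a smallest set S whose
complement has components in small balls. Replacing the part of S inside a
ball by the boundary sphere of the ball gives another such set, so S meets a
ball in at most as many vertices as there are on its boundary sphere
([minimal_cut]). A ball that is thick in S at one radius would therefore grow
by at least t^(d-1) at t successive radii, and contain at least t^d > n
vertices; hence S is thin in all balls, and it splits into d - 1 sets by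
induction. A set that is thin enough has components in small balls, since a
connected set reaching distance r has a vertex at each distance up to r
([thin_clustered]). *)

Set Implicit Arguments.
Unset Strict Implicit.
Unset Printing Implicit Defensive.

(** * Coboundaries and alternating words *)

(** Cochains mod 2 are boolean functions on words. The recursion on the word,
with the already read letters absorbed into [phi], makes the identities below
provable without indices. *)
Fixpoint coboundary (T : Type) (phi : seq T -> bool) (t : seq T) : bool :=
  if t is x :: t' then phi t' (+) coboundary (fun s => phi (x :: s)) t'
  else false.

Lemma eq_coboundary (T : eqType) (phi psi : seq T -> bool) (t : seq T) :
  (forall s, subseq s t -> phi s = psi s) ->
  coboundary phi t = coboundary psi t.
Proof.
elim: t phi psi => [//|x t IH] phi psi eqf /=.
rewrite eqf ?subseq_cons //; congr (_ (+) _).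
by apply: IH => s st; apply: eqf; rewrite /= eqxx.
Qed.

Lemma eq_coboundary_ext (T : Type) (phi psi : seq T -> bool) :
  phi =1 psi -> coboundary phi =1 coboundary psi.
Proof.
move=> + t; elim: t phi psi => [//|x t IH] phi psi eqf /=.
by rewrite eqf; congr (_ (+) _); apply: IH => s; apply: eqf.
Qed.

Lemma coboundaryD (T : Type) (phi psi : seq T -> bool) t :
  coboundary (fun s => phi s (+) psi s) t =
  coboundary phi t (+) coboundary psi t.
Proof.
by elim: t phi psi => [//|x t IH] phi psi /=; rewrite IH addbACA.
Qed.

Lemma coboundary_map (T U : Type) (f : T -> U) (phi : seq U -> bool) t :
  coboundary phi (map f t) = coboundary (fun s => phi (map f s)) t.
Proof. by elim: t phi => [//|x t IH] phi /=; rewrite IH. Qed.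

Lemma perm_mid (T : eqType) (x : T) t1 t2 :
  perm_eq (t1 ++ x :: t2) (x :: t1 ++ t2).
Proof. by apply/permPl/(perm_catCA t1 [:: x] t2). Qed.

Lemma coboundary_mid (T : eqType) (phi : seq T -> bool) x t1 t2 :
    (forall s t, perm_eq s t -> phi s = phi t) ->
  coboundary phi (t1 ++ x :: t2) = coboundary phi (x :: t1 ++ t2).
Proof.
elim: t1 phi => [//|y t1 IH] phi sym /=.
rewrite IH => [|s t st]; last by apply: sym; rewrite perm_cons.
rewrite /= (sym (t1 ++ x :: t2) (x :: t1 ++ t2)) ?perm_mid //.
rewrite addbCA; congr (_ (+) (_ (+) _)); apply: eq_coboundary_ext => s.
by apply: sym; exact: (perm_mid x [:: y] s).
Qed.

(** For a symmetric cochain the order in which letters are deleted is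
irrelevant; this allows the labels of a simplex to be sorted before counting.
*)
Lemma perm_coboundary (T : eqType) (phi : seq T -> bool) s t :
    (forall s t, perm_eq s t -> phi s = phi t) ->
  perm_eq s t -> coboundary phi s = coboundary phi t.
Proof.
elim: s t phi => [|x s IH] t phi sym.
  by move=> /perm_size/esym/size0nil ->.
move=> st; have xt : x \in t by rewrite -(perm_mem st) mem_head.
case/splitPr: xt st => t1 t2 st.
have st' : perm_eq s (t1 ++ t2).
  by rewrite -(perm_cons x) (perm_trans st) ?perm_mid.
rewrite coboundary_mid //= (sym _ _ st'); congr (_ (+) _).
by apply: IH => // s' t' st2; apply: sym; rewrite perm_cons.
Qed.

Fixpoint alternating (b : bool) (w : seq bool) : bool :=
  if w is x :: w' then (x == b) && alternating (~~ b) w' else true.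

Lemma coboundary0 (T : Type) (t : seq T) : coboundary (fun=> false) t = false.
Proof. by elim: t. Qed.

(** Deleting a letter from an alternating word leaves an alternating word only
if it was the first or the last one, and a word with exactly one equal pair of
neighbours can be repaired in exactly two ways, which cancel. *)
Lemma coboundary_alternating b w :
  coboundary (alternating b) w = alternating b w (+) alternating (~~ b) w.
Proof.
elim: w b => [//|x w IH] b /=; case: eqVneq => [->|xb] /=.
  rewrite IH negbK.
  by case: b {IH}; case: (alternating _ _); case: (alternating _ _).
rewrite coboundary0 addbF negbK; suff -> : (x == ~~ b) by [].
by case: x b xb => [] [].
Qed.

(** A label [2 * c + b] stands for the color [c] with the sign [b]. A simplex
counts when its signs, sorted by color, alternate starting with [b]. *)
Definition fan (b : bool) (ls : seq nat) : bool :=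
  alternating b (map odd (sort leq ls)).

Lemma fan_perm b s t : perm_eq s t -> fan b s = fan b t.
Proof.
by move=> /(perm_sortP leq_total leq_trans anti_leq); rewrite /fan => ->.
Qed.

(** This is the combinatorial heart of Fan's lemma: mod 2, the facets of a
simplex that alternate from [b] count whether the simplex itself alternates.
*)
Lemma coboundary_fan b ls : coboundary (fan b) ls = fan b ls (+) fan (~~ b) ls.
Proof.
rewrite (perm_coboundary (t := sort leq ls)).
- rewrite (eq_coboundary (psi := fun s => alternating b (map odd s))) =>
    [|s st].
    by rewrite -coboundary_map coboundary_alternating.
  rewrite /fan sorted_sort //; first exact: leq_trans.
  by apply: (subseq_sorted leq_trans st); exact: sort_sorted leq_total _.
- exact: fan_perm.
- by rewrite perm_sym perm_sort.
Qed.

Lemma fan_repeat b s1 x s2 : fan b (s1 ++ x :: x :: s2) = false.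
Proof.
have -> : fan b (s1 ++ x :: x :: s2) = fan b (x :: x :: (s1 ++ s2)).
  by apply: fan_perm; apply/permPl/(perm_catCA s1 [:: x; x] s2).
rewrite /fan; set s := sort leq _.
have ss : sorted leq s by apply: sort_sorted leq_total _.
have : 1 < count_mem x s.
  by rewrite (permP (permEl (perm_sort _ _))) /= eqxx.
move: s ss => s; elim: s b => [//|y s IH] b /=.
case: eqVneq => [->|yx] /= ps cs; last first.
  by rewrite (IH (~~ b)) ?andbF // (path_sorted ps).
case: s ps cs {IH} => [//|z s] /= /andP[xz ps].
have [->|zx] := eqVneq z x; first by case: b; case: (odd x).
rewrite add0n add1n ltnS -has_count => /hasP[w /= ws /eqP wx].
move/(order_path_min leq_trans)/allP: ps => /(_ _ ws); rewrite wx => zx'.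
by move: zx; rewrite eqn_leq xz zx'.
Qed.

Definition opp_label (l : nat) := ~~ odd l + l./2.*2.

Lemma odd_opp_label l : odd (opp_label l) = ~~ odd l.
Proof. by rewrite /opp_label oddD odd_double addbF oddb. Qed.

Lemma half_opp_label l : (opp_label l)./2 = l./2.
Proof.
by rewrite /opp_label; case: odd; rewrite /= ?add0n ?doubleK // uphalf_double.
Qed.

Lemma opp_labelK : involutive opp_label.
Proof.
by move=> l; rewrite {1}/opp_label odd_opp_label half_opp_label negbK
  odd_double_half.
Qed.

Lemma label_eq l m : odd l = odd m -> l./2 = m./2 -> l = m.
Proof. by move=> o h; rewrite -[l]odd_double_half -[m]odd_double_half o h. Qed.

Definition consistent (ls : seq nat) := {in ls &, forall l m, l <> opp_label m}.

Lemma lt_half l m : l <> m -> l <> opp_label m -> l <= m -> l./2 < m./2.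
Proof.
move=> lm lnm le; rewrite ltn_neqAle half_leq // andbT; apply/eqP => h.
case: (boolP (odd l == odd m)) => [/eqP o|o]; first exact/lm/label_eq.
apply: lnm; apply: label_eq; rewrite ?half_opp_label // odd_opp_label.
by case: odd o; case: odd.
Qed.

(** Consistency is what makes the sign change preserve the sorting by color:
two labels of the same color are then equal. *)
Lemma fan_opp_label b ls :
  consistent ls -> fan b (map opp_label ls) = fan (~~ b) ls.
Proof.
move=> cs; rewrite /fan; set s := sort leq ls.
have -> : sort leq (map opp_label ls) = map opp_label s.
  apply: (sorted_eq leq_trans anti_leq); first exact: sort_sorted leq_total _.
    rewrite sorted_map; have : sorted leq s by apply: sort_sorted leq_total _.
    apply: (sub_in_sorted (P := mem ls)) => [l m lls mls le /=|].
      case: (eqVneq l m) => [->//|/eqP lm].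
      have := lt_half lm (cs _ _ lls mls) le.
      rewrite -(half_opp_label l) -(half_opp_label m).
      by apply: contraTT; rewrite -ltnNge -leqNgt => /ltnW/half_leq.
    by apply/allP => l; rewrite mem_sort.
  by rewrite perm_sort perm_map // perm_sym perm_sort.
elim: {cs}s b => [//|x s IH] b /=; rewrite odd_opp_label IH.
by case: (odd x); case: b.
Qed.

(** In a consistent sorted word neighbours of different sign have different
colors, so alternation forces all colors to be distinct. *)
Lemma fan_size b ls q :
  consistent ls -> (forall l, l \in ls -> l./2 < q) -> fan b ls -> size ls <= q.
Proof.
move=> cs lq; rewrite /fan -(size_sort leq) => alt.
have : consistent (sort leq ls) by move=> l m; rewrite !mem_sort; apply: cs.
have {}lq l : l \in sort leq ls -> l./2 < q by rewrite mem_sort; apply: lq.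
have : sorted leq (sort leq ls) by apply: sort_sorted leq_total _.
move: (sort leq ls) lq alt => s lq alt ss {}cs.
suff su : uniq (map half s).
  rewrite -(size_iota 0 q) -(size_map half); apply: uniq_leq_size => // h.
  by case/mapP => l /lq lq' ->; rewrite mem_iota add0n.
apply: (sorted_uniq ltn_trans ltnn).
elim: s b ss cs alt {lq} => [//|x [//|y s] IH] b ss cs alt.
have [xy ps] : x <= y /\ sorted leq (y :: s) by move: ss => /= /andP[].
move: alt => /= /andP[/eqP ox /andP[/eqP oy alt]].
apply/andP; split.
  apply: lt_half => //; last by apply: cs; rewrite !inE eqxx ?orbT.
  by move=> xy'; move: ox oy; rewrite xy' => ->; case: b {alt}.
apply: (IH (~~ b)) => //; last by rewrite /= oy eqxx.
by move=> l m l1 m1; apply: cs; rewrite inE ?l1 ?m1 orbT.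
Qed.

(** * Prisms *)

(** The prism over [t = v_0 ... v_k] is triangulated by the simplices [lo v_0
... lo v_i, hi v_i ... hi v_k]; this is the sum of [psi] over them. *)
Fixpoint prism (T U : Type) (lo hi : T -> U) (psi : seq U -> bool) (t : seq T)
    : bool :=
  if t is v :: t' then
    psi (lo v :: map hi t) (+) prism lo hi (fun s => psi (lo v :: s)) t'
  else false.

Lemma eq_prism (T U : Type) (lo hi : T -> U) (phi psi : seq U -> bool) t :
    (forall t1 v t2, t = t1 ++ v :: t2 ->
      phi (map lo (rcons t1 v) ++ map hi (v :: t2)) =
      psi (map lo (rcons t1 v) ++ map hi (v :: t2))) ->
  prism lo hi phi t = prism lo hi psi t.
Proof.
elim: t phi psi => [//|v t IH] phi psi eqf /=.
rewrite -/(map hi (v :: t)) -(cat1s (lo v)) (eqf [::] v t erefl).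
congr (_ (+) _); apply: IH => t1 w t2 tE.
by apply: (eqf (v :: t1) w t2); rewrite tE.
Qed.

Lemma eq_prism_ext (T U : Type) (lo hi lo' hi' : T -> U)
    (phi psi : seq U -> bool) t :
    lo =1 lo' -> hi =1 hi' -> phi =1 psi ->
  prism lo hi phi t = prism lo' hi' psi t.
Proof.
move=> l h; elim: t phi psi => [//|v t IH] phi psi eqf /=.
rewrite eqf l h (eq_map h); congr (_ (+) _); apply: IH => s.
by rewrite eqf.
Qed.

Lemma prismD (T U : Type) (lo hi : T -> U) (phi psi : seq U -> bool) t :
  prism lo hi (fun s => phi s (+) psi s) t =
  prism lo hi phi t (+) prism lo hi psi t.
Proof.
by elim: t phi psi => [//|v t IH] phi psi /=; rewrite IH addbACA.
Qed.

(** The prism operator is a chain homotopy between [map lo] and [map hi]. *)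
Lemma prism_coboundary (T U : Type) (lo hi : T -> U) (psi : seq U -> bool) t :
  prism lo hi (coboundary psi) t =
  coboundary (prism lo hi psi) t (+) (psi (map lo t) (+) psi (map hi t)).
Proof.
elim: t psi => [|v t IH] psi /=; first by case: (psi _).
rewrite !prismD IH coboundaryD coboundary_map /=.
set a := psi (_ :: map hi t); set b := coboundary (fun s : seq T => _ _) t.
set c := prism _ _ _ _; set d := coboundary _ t.
set e := psi (_ :: map lo t); set f := psi _.
by case: a; case: b; case: c; case: d; case: e; case: f.
Qed.

Lemma prism_map (T T' U : Type) (lo hi : T' -> U) (f : T -> T') psi t :
  prism lo hi psi (map f t) =
  prism (fun v => lo (f v)) (fun v => hi (f v)) psi t.
Proof. by elim: t psi => [//|v t IH] psi /=; rewrite IH -map_comp. Qed.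

Lemma prism_comp (T U U' : Type) (lo hi : T -> U) (f : U -> U') psi t :
  prism lo hi (fun s => psi (map f s)) t =
  prism (fun v => f (lo v)) (fun v => f (hi v)) psi t.
Proof.
elim: t psi => [//|v t IH] psi /=.
by rewrite -IH -map_comp.
Qed.

Lemma prism_rcons (T U : Type) (lo hi : T -> U) psi t v :
  prism lo hi psi (rcons t v) =
  prism lo hi (fun s => psi (rcons s (hi v))) t
    (+) psi (rcons (map lo (rcons t v)) (hi v)).
Proof.
elim: t psi => [|w t IH] psi /=; first by rewrite addbF.
by rewrite IH map_rcons addbA.
Qed.

(** Turning a prism upside down gives the prism over the reversed simplex.
Hence the triangulation of a suspension is compatible with the antipodal map,
provided that the latter also reverses the order of the vertices. *)
Lemma prism_rev (T U : Type) (lo hi : T -> U) psi t :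
  prism lo hi psi (rev t) = prism hi lo (fun s => psi (rev s)) t.
Proof.
elim: t psi => [//|v t IH] psi; rewrite rev_cons prism_rcons IH /= addbC.
congr (_ (+) _); last by apply: eq_prism_ext => // s; rewrite rev_cons.
by rewrite !rev_cons -map_rev map_rcons.
Qed.

(** Such cochains do not see collapsed simplices, which appear where a prism
is squeezed into a pole of the suspension. *)
Definition nondegenerate (T : Type) (psi : seq T -> bool) :=
  forall s1 x s2, psi (s1 ++ x :: x :: s2) = false.

Lemma prism0 (T U : Type) (lo hi : T -> U) t :
  prism lo hi (fun=> false) t = false.
Proof. by elim: t. Qed.

Lemma prism_nondegenerate (T U : Type) (lo hi : T -> U) psi :
  nondegenerate psi -> nondegenerate (prism lo hi psi).
Proof.
move=> + s1 x s2; elim: s1 psi => [|y s1 IH] psi nd /=.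
  have := nd [:: lo x] (hi x) (map hi s2); rewrite /= => ->.
  have := nd [::] (lo x) (map hi (x :: s2)); rewrite /= => -> /=.
  rewrite (eq_prism_ext (psi := fun=> false) s2 (frefl lo) (frefl hi)).
    exact: prism0.
  by move=> s; exact: (nd [::]).
have := nd [:: lo y, hi y & map hi s1] (hi x) (map hi s2).
rewrite /= map_cat /= => ->; rewrite IH // => s1' x' s2'.
exact: (nd (lo y :: s1')).
Qed.

(** * The iterated suspension *)

Definition heights_close (a b : nat) := (a <= b.+1) && (b <= a.+1).

(** Points are sequences of heights, and two points touch when their heights
differ by at most 1 as long as both are defined: near a pole, where a sequence
ends, all directions touch. *)
Definition touching (x y : seq nat) :=
  all (fun ab => heights_close ab.1 ab.2) (zip x y).

Definition antipode (g : nat) (x : seq nat) := map (subn g) x.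

(** The point at height [h] above [x] in the suspension of the sphere of [x]:
the heights [0] and [g] are the poles, where [x] is forgotten. *)
Definition level (g h : nat) (x : seq nat) :=
  if (h == 0) || (h == g) then [:: h] else h :: x.

(** A point of the [d]-dimensional sphere lists its successive suspension
heights, strictly between [0] and [g], until a pole [0] or [g] is reached
after at most [d] of them. The antipodal map exchanges the two poles, so the
points that end in [0] represent the antipodal pairs. *)
Fixpoint sphere_reps (g d : nat) : seq (seq nat) :=
  [:: 0] :: (if d is d'.+1 then
    [seq h :: r | h <- iota 1 g.-1, r <- sphere_reps g d'] else [::]).

Definition sphere_point g d x :=
  (x \in sphere_reps g d) || (x \in map (antipode g) (sphere_reps g d)).

Lemma level_bot g x : level g 0 x = [:: 0]. Proof. by []. Qed.

Lemma level_top g x : level g g x = [:: g].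
Proof. by rewrite /level eqxx orbT. Qed.

Lemma size_sphere_reps g d : 1 < g -> size (sphere_reps g d) <= d.+1 * g.-1 ^ d.
Proof.
move=> g1; elim: d => [//|d IH] /=.
rewrite size_allpairs size_iota expnS.
have : 0 < g.-1 ^ d.+1 by rewrite expn_gt0; lia.
rewrite expnS; move: (g.-1 ^ d) IH => e; nia.
Qed.

Lemma antipode_level g h x : h <= g ->
  antipode g (level g h x) = level g (g - h) (antipode g x).
Proof.
move=> hg; rewrite /level.
have -> : (g - h == 0) || (g - h == g) = (h == 0) || (h == g).
  by apply/idP/idP; lia.
by case: ifP.
Qed.

Lemma sphere_repsP g d r : r \in sphere_reps g d ->
  r = [:: 0] \/
  exists h r', [/\ 0 < h < g, 0 < d, r' \in sphere_reps g d.-1 & r = h :: r'].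
Proof.
case: d => [|d]; rewrite inE; first by move/eqP->; left.
case/predU1P => [->|]; first by left.
case/allpairsP => -[h r'] /= []; rewrite mem_iota => hh rr ->; right.
by exists h, r'; split=> //; lia.
Qed.

Lemma sphere_reps_last g d x : x \in sphere_reps g d -> last 1 x = 0.
Proof.
elim: d x => [|d IH] x /sphere_repsP[-> //|[h [r [_ // _ rr ->]]]] /=.
by have := IH _ rr; case: r {rr}.
Qed.

Lemma antipodeK g x : all (fun h => h <= g) x -> antipode g (antipode g x) = x.
Proof.
by elim: x => [//|h x IH] /= /andP[hg /IH ->]; rewrite subKn.
Qed.

Lemma sphere_reps_le g d x :
  1 < g -> x \in sphere_reps g d -> all (fun h => h <= g) x.
Proof.
move=> g1; elim: d x => [|d IH] x /sphere_repsP[-> //|[h [r [hg // _ rr ->]]]].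
by rewrite /= (IH _ rr) andbT; lia.
Qed.

Lemma sphere_reps_cons g d h r :
  0 < h < g -> r \in sphere_reps g d -> h :: r \in sphere_reps g d.+1.
Proof.
move=> hg rr; rewrite /= inE; apply/orP; right; apply/allpairsP.
by exists (h, r); rewrite mem_iota; split => //=; lia.
Qed.

Lemma sphere_repsS g d : {subset sphere_reps g d <= sphere_reps g d.+1}.
Proof.
elim: d => [|d IH] x /sphere_repsP[->|[h [r [hg d0 rr ->]]]] //;
  try exact: mem_head.
by apply/sphere_reps_cons/IH.
Qed.

Lemma sphere_pointS g d x : sphere_point g d x -> sphere_point g d.+1 x.
Proof.
rewrite /sphere_point => /orP[/sphere_repsS-> //|/mapP[r /sphere_repsS rr ->]].
by rewrite map_f // orbT.
Qed.

Lemma sphere_pointP g d x : sphere_point g d x ->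
  (x = [:: 0] \/ x = [:: g]) \/
  exists h x', [/\ 0 < h < g, 0 < d, sphere_point g d.-1 x' & x = h :: x'].
Proof.
case/orP => [/sphere_repsP[->|]|/mapP[r /sphere_repsP rr ->]].
- by left; left.
- case=> h [r [hg d0 rr ->]]; right; exists h, r; split=> //.
  by rewrite /sphere_point rr.
case: rr => [->|]; first by left; right; rewrite /= subn0.
case=> h [r' [hg d0 rr ->]]; right; exists (g - h), (antipode g r'); split=> //.
  by lia.
by rewrite /sphere_point map_f ?orbT.
Qed.

Lemma antipode_sphere_pointK g d x :
  1 < g -> sphere_point g d x -> antipode g (antipode g x) = x.
Proof.
move=> g1 /orP[|/mapP[r rr ->]]; first by move/(sphere_reps_le g1)/antipodeK.
by rewrite (antipodeK (sphere_reps_le g1 rr)).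
Qed.

Lemma sphere_point_antipode g d x :
  1 < g -> sphere_point g d x -> sphere_point g d (antipode g x).
Proof.
move=> g1 /orP[xr|/mapP[r rr ->]]; first by rewrite /sphere_point map_f ?orbT.
by rewrite (antipodeK (sphere_reps_le g1 rr)) /sphere_point rr.
Qed.

Lemma sphere_point_level g d h x :
  0 < g -> h <= g -> sphere_point g d x -> sphere_point g d.+1 (level g h x).
Proof.
move=> g0 hg.
rewrite /sphere_point /level; case: ifP => [/orP[]/eqP->|hh] //.
  by rewrite /= subn0 mem_head orbT.
case/orP => [xr|/mapP[r rr ->]]; apply/orP; [left|right].
  by apply: sphere_reps_cons => //; lia.
have -> : h :: antipode g r = antipode g ((g - h) :: r) by rewrite /= subKn.
by apply/map_f/sphere_reps_cons => //; lia.
Qed.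

Lemma touching_level g h h' x y : heights_close h h' -> touching x y ->
  touching (level g h x) (level g h' y).
Proof.
rewrite /touching /level => n xy.
by case: ifP => _; case: ifP => _ /=; rewrite n //=; case: x xy; case: y.
Qed.

Lemma touchingC x y : touching x y = touching y x.
Proof.
rewrite /touching; elim: x y => [|a x IH] [|b y] //=.
by rewrite IH /heights_close [X in X && _]andbC.
Qed.

Lemma touching_antipode g x y :
  touching x y -> touching (antipode g x) (antipode g y).
Proof.
rewrite /touching; elim: x y => [|a x IH] [|b y] //= /andP[ab /IH ->].
by rewrite andbT; move: ab; rewrite /heights_close; lia.
Qed.

(** * Hemispheres and the antipodal labelling theorem *)

Section Hemisphere.
Variable (g : nat).
Hypothesis g1 : 1 < g.

(** The prisms between consecutive levels triangulate the suspension of the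
simplex [t]. *)
Definition suspension (psi : seq (seq nat) -> bool) t :=
  \big[addb/false]_(h < g) prism (level g h) (level g h.+1) psi t.

(** The chain of an upper hemisphere of dimension [k], represented by its
pairing with cochains. It is a point for [k = 0], and otherwise the suspension
of an upper hemisphere of one dimension less. *)
Fixpoint hemisphere k (psi : seq (seq nat) -> bool) : bool :=
  if k is k'.+1 then hemisphere k' (suspension psi) else psi [:: [:: 0]].

Definition reverse_antipode (t : seq (seq nat)) := rev (map (antipode g) t).

(** A property shared by all simplices of the hemisphere of dimension [k]; see
[eq_hemisphere]. *)
Definition cell k (t : seq (seq nat)) :=
  [/\ size t = k.+1, {in t, forall x, sphere_point g k x}
    & {in t &, forall x y, touching x y}].

Lemma eq_hemisphere k phi psi :
  (forall t, cell k t -> phi t = psi t) -> hemisphere k phi = hemisphere k psi.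
Proof.
elim: k phi psi => [|k IH] phi psi eqf /=.
  apply: eqf; split=> // x; first by rewrite inE => /eqP->.
  by move=> y; rewrite !inE => /eqP-> /eqP->.
apply: IH => t [st pt ct]; apply: eq_bigr => h _; apply: eq_prism => t1 v t2 tE.
apply: eqf.
have lev x :
    x \in map (level g h) (rcons t1 v) ++ map (level g h.+1) (v :: t2) ->
    exists b : bool, exists2 y, y \in t & x = level g (b + h) y.
  rewrite mem_cat => /orP[] /mapP[y yt ->].
    by exists false, y => //; rewrite tE -cat_rcons mem_cat yt.
  by exists true, y => //; rewrite tE mem_cat yt orbT.
split.
- by move: st; rewrite tE !size_cat !size_map size_rcons /=; lia.
- move=> x /lev[b [y yt ->]]; apply: sphere_point_level; rewrite ?pt //;
    first lia.
  by case: h {lev} => h /=; case: b; lia.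
move=> x x' /lev[b [y yt ->]] /lev[b' [y' yt' ->]].
apply: touching_level; rewrite ?ct // /heights_close.
by case: b; case: b'; lia.
Qed.

Lemma hemisphereD k phi psi :
  hemisphere k (fun s => phi s (+) psi s) =
  hemisphere k phi (+) hemisphere k psi.
Proof.
elim: k phi psi => [//|k IH] phi psi /=; rewrite -IH.
apply: eq_hemisphere => t _; rewrite /suspension -big_split.
by apply: eq_bigr => h _; rewrite prismD.
Qed.

Lemma telescope_addb (f : nat -> bool) n :
  \big[addb/false]_(h < n) (f h (+) f h.+1) = f 0 (+) f n.
Proof.
elim: n => [|n IH]; first by rewrite big_ord0 addbb.
by rewrite big_ord_recr /= IH; case: (f 0); case: (f n); case: (f _.+1).
Qed.

Lemma coboundary_sum n (F : 'I_n -> seq (seq nat) -> bool) t :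
  \big[addb/false]_(h < n) coboundary (F h) t =
  coboundary (fun s => \big[addb/false]_(h < n) F h s) t.
Proof.
elim: t F => [|x t IH] F /=; first by rewrite big1.
by rewrite big_split IH.
Qed.

Lemma suspension_coboundary psi t :
  suspension (coboundary psi) t =
  coboundary (suspension psi) t (+)
    (psi (map (level g 0) t) (+) psi (map (level g g) t)).
Proof.
rewrite -(telescope_addb (fun h => psi (map (level g h) t))) /suspension.
rewrite -coboundary_sum -big_split.
by apply: eq_bigr => h _; rewrite prism_coboundary.
Qed.

Lemma suspension_reverse_antipode psi t :
  suspension (fun s => psi (reverse_antipode s)) t =
  suspension psi (reverse_antipode t).
Proof.
(* The antipodal map exchanges the slabs [h, h + 1] and [g - h - 1, g - h]. *)
rewrite /suspension (reindex_inj rev_ord_inj) /=; apply: eq_bigr => h _.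
rewrite (prism_comp _ _ (antipode g) (fun s => psi (rev s))).
rewrite prism_rev prism_map.
apply: eq_prism_ext => // x; rewrite antipode_level;
  by [congr level; case: h => h /=; lia | lia].
Qed.

(** The boundary of a hemisphere is a sphere of one dimension less, that is, a
hemisphere and its antipodal image, up to collapsed simplices. *)
Lemma hemisphere_boundary k psi : nondegenerate psi ->
  hemisphere k.+1 (coboundary psi) =
  hemisphere k psi (+) hemisphere k (fun s => psi (reverse_antipode s)).
Proof.
elim: k psi => [|k IH] psi nd.
  rewrite [LHS]/= suspension_coboundary /= level_bot level_top.
  rewrite /suspension big1 //=.
  by rewrite /reverse_antipode /= subn0.
(* The top and bottom faces of the suspension are collapsed into the poles. *)
have sx : hemisphere k.+2 (coboundary psi) =
    hemisphere k.+1 (coboundary (suspension psi)).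
  change (hemisphere k.+1 (suspension (coboundary psi)) =
          hemisphere k.+1 (coboundary (suspension psi))).
  apply: eq_hemisphere => t [st _ _]; rewrite suspension_coboundary.
  case: t st => [//|x [//|y t]] _.
  rewrite /= !level_bot !level_top.
  by rewrite (nd [::] [:: 0]) (nd [::] [:: g]) !addbF.
rewrite sx IH; last first.
  move=> s1 x s2; rewrite /suspension big1 // => h _.
  exact: prism_nondegenerate.
congr (_ (+) _); apply: eq_hemisphere => t _.
by rewrite suspension_reverse_antipode.
Qed.

Definition antipodal_labelling k (lam : seq nat -> nat) :=
  (forall x, sphere_point g k x -> lam (antipode g x) = opp_label (lam x)) /\
  (forall x y, sphere_point g k x -> sphere_point g k y -> touching x y ->
     lam x <> opp_label (lam y)).

Lemma antipodal_labellingS k lam :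
  antipodal_labelling k.+1 lam -> antipodal_labelling k lam.
Proof.
by case=> anti cons;
  split=> [x /sphere_pointS|x y /sphere_pointS xs /sphere_pointS]; auto.
Qed.

Lemma cell_consistent k lam t :
  antipodal_labelling k lam -> cell k t -> consistent (map lam t).
Proof.
move=> [_ cons] [_ pt ct] _ _ /mapP[x xt ->] /mapP[y yt ->].
by apply: cons; [exact: pt | exact: pt | exact: ct].
Qed.

(** The parity of the number of alternating simplices does not depend on the
dimension: by [coboundary_fan] it is, in dimension [k + 1], the number of
simplices of the boundary sphere that alternate from [true]. Those in the
lower half are antipodal to simplices of the upper half that alternate from
[false]. *)
Lemma fan_hemisphere k (lam : seq nat -> nat) :
    antipodal_labelling k lam ->
  hemisphere k (fun t => fan true (map lam t) (+) fan false (map lam t)).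
Proof.
elim: k => [|k IH] lamP; first by rewrite /= /fan /= !andbT; case: (odd _).
have {}lamP := antipodal_labellingS lamP.
suff -> : hemisphere k.+1
    (fun t => fan true (map lam t) (+) fan false (map lam t)) =
    hemisphere k (fun t => fan true (map lam t) (+) fan false (map lam t)).
  exact: IH.
rewrite [RHS]hemisphereD.
have -> : hemisphere k (fun t => fan false (map lam t)) =
          hemisphere k (fun t => fan true (map lam (reverse_antipode t))).
  apply: eq_hemisphere => t ct; have [_ pt _] := ct.
  rewrite -[false]/(~~ true) -fan_opp_label;
    last exact: cell_consistent lamP ct.
  rewrite /reverse_antipode map_rev -map_comp -map_comp.
  rewrite (@fan_perm _ (rev _) _ (permEl (perm_rev _))).
  congr fan; apply/eq_in_map => x xt /=.
  by rewrite (proj1 lamP) //; exact: pt.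
rewrite -(@hemisphere_boundary k (fun t => fan true (map lam t))).
  apply: eq_hemisphere => t _; rewrite -coboundary_map coboundary_fan //.
by move=> s1 x s2; rewrite map_cat fan_repeat.
Qed.

(** An odd number of alternating [d]-simplices means at least one, and its [d
+ 1] colors are distinct. *)
Lemma antipodal_labelling_size d q (lam : seq nat -> nat) :
    antipodal_labelling d lam ->
    (forall x, sphere_point g d x -> (lam x)./2 < q) ->
  d < q.
Proof.
move=> lamP lq; have := fan_hemisphere lamP.
rewrite ltnNge; apply: contraTN => qd.
rewrite (@eq_hemisphere _ _ (fun=> false)); last first.
  move=> t ct; have [st pt _] := ct.
  have cs := cell_consistent lamP ct.
  have fF b : fan b (map lam t) = false.
    apply/negP => fb.
    suff: size (map lam t) <= q by rewrite size_map st ltnNge qd.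
    by apply: fan_size cs _ fb => _ /mapP[x xt ->]; apply/lq/pt.
  by rewrite !fF.
elim: (d) => [//|k IH]; rewrite /= (@eq_hemisphere _ _ (fun=> false)) // => t _.
by rewrite /suspension big1 // => h _; rewrite prism0.
Qed.

End Hemisphere.

(** * Antipodal points are far apart *)

Lemma sphere_point_neq0 g d x : sphere_point g d x -> x != [::].
Proof. by case/sphere_pointP => [[]->|[? [? [_ _ _ ->]]]]. Qed.

(** The first height changes by at most 1 at each step. *)
Lemma touching_path_head x p : path touching x p ->
  all (fun y => y != [::]) (x :: p) ->
  (head 0 x <= head 0 (last x p) + size p) /\
  (head 0 (last x p) <= head 0 x + size p).
Proof.
elim: p x => [|y p IH] x /=; first by rewrite addn0.
case/andP => xy /IH{}IH /and3P[x0 y0 p0].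
have {IH} [] := IH; first by rewrite /= y0.
have : heights_close (head 0 x) (head 0 y).
  by case: x x0 xy => [//|a x] _; case: y y0 {p0} => [//|b y] _ /andP[].
rewrite /heights_close; lia.
Qed.

(** If the path meets a pole of the outermost suspension, its first height
goes from some [h] to [0] or [g] and then to [g - h], which takes [g] steps.
Otherwise the first heights can be dropped, which leaves a path between
antipodal points of the sphere of one dimension less. *)
Lemma touching_path_antipode g d x p : 1 < g ->
    all (sphere_point g d) (x :: p) -> path touching x p ->
    last x p = antipode g x ->
  g <= size p.
Proof.
move=> g1; elim: d x p => [|d IH] x p sp cp lp.
  have [px pl] := touching_path_head cp (sub_all (@sphere_point_neq0 g 0) sp).
  move: sp px pl lp => /= /andP[/sphere_pointP[[]->|[h [x' [_ //]]]] _] + + lp.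
    by rewrite lp /= subn0.
  by rewrite lp /=; lia.
have [/hasP[y yp y0]|/hasPn np] :=
    boolP (has (fun y => y \in [:: [:: 0]; [:: g]]) (x :: p)).
  have [p1 [p2 [pE yE]]] : exists p1 p2, p = p1 ++ p2 /\ y = last x p1.
    by case/splitPl: yp => p1 p2 <-; exists p1, p2.
  move: sp cp lp; rewrite pE cat_path last_cat -cat_cons all_cat size_cat -yE.
  move=> /andP[sp1 sp2] /andP[c1 c2] lp.
  have [] := touching_path_head c1 (sub_all (@sphere_point_neq0 g d.+1) sp1).
  have [] := @touching_path_head y p2 c2 _.
    apply: (sub_all (@sphere_point_neq0 g d.+1)); rewrite /= sp2 andbT.
    by rewrite yE; move/allP: sp1; apply; exact: mem_last.
  rewrite -yE lp.
  have -> : head 0 (antipode g x) = g - head 0 x.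
    by move: sp1 => /= /andP[/sphere_point_neq0]; case: (x).
  have : head 0 x <= g.
    move: sp1 => /= /andP[/sphere_pointP[[]->|[h [x' [hg _ _ ->]]]] _] //=; lia.
  by move: y0; rewrite !inE => /orP[]/eqP-> /=; lia.
rewrite -(size_map behead); apply: (IH (behead x)).
- rewrite -map_cons all_map; apply/allP => y yp /=.
  case: (sphere_pointP (allP sp _ yp)) (np _ yp) =>
    [[]->|[h [x' [_ _ sx ->]]]] //.
  by rewrite !inE eqxx orbT.
- rewrite path_map; apply: sub_path cp => a b /=.
  by case: a b => [|a a'] [|b b'] //=; [case: b' | case: a' | case/andP].
- by rewrite last_map lp; case: (x).
Qed.

(** * Switching, signed walks and negative cycles *)

Lemma edge_neq (T : finType) (G : sgraph T) (u w : T) b :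
  ([set u; w], b) \in edges G -> u != w.
Proof.
move=> e; have := forall_inP (edges_card2 G) _ e.
by rewrite /= cards2; case: (u != w).
Qed.

Definition flips (T : finType) (s : seq T) (e : sedge T) : sedge T :=
  foldr (@flip_at T) e s.

Lemma flip_atK (T : finType) (v : T) : involutive (flip_at v).
Proof. by move=> [e b]; rewrite /flip_at /= addbA addbb. Qed.

Lemma mem_flips (T : finType) (G : sgraph T) s e :
  (flips s e \in edges (foldr (@switch T) G s)) = (e \in edges G).
Proof.
elim: s => [//|v s IH] /=.
by rewrite (mem_imset _ _ (can_inj (flip_atK v))) IH.
Qed.

Lemma flipsE (T : finType) (s : seq T) (u w : T) b : u != w ->
  flips s ([set u; w], b) =
  ([set u; w], odd (count_mem u s) (+) odd (count_mem w s) (+) b).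
Proof.
move=> uw; elim: s => [//|v s IH] /=; rewrite IH /flip_at /= !inE !oddD !oddb.
congr (_, _); have [vu|vu] := eqVneq v u; have [vw|vw] /= := eqVneq v w.
- by rewrite -vu vw eqxx in uw.
- by case: (odd _); case: (odd _); case: b {IH}.
- by case: (odd _); case: (odd _); case: b {IH}.
- by [].
Qed.

(** Switching a sequence of vertices only depends on the parity of the number
of times that each vertex occurs in it. *)
Lemma balancedP (T : finType) (G : sgraph T) (B : {set T}) :
  balanced G B <-> exists s : T -> bool, forall u w b,
    ([set u; w], b) \in edges G -> u \in B -> w \in B -> b = s u (+) s w.
Proof.
split=> [[s sP]|[s sP]].
  exists (fun u => odd (count_mem u s)) => u w b e uB wB.
  have := sP (flips s ([set u; w], b)); rewrite mem_flips inE e /=.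
  rewrite finset.subUset !finset.sub1set uB wB => /(_ isT).
  by rewrite flipsE ?(edge_neq e) //=; case: odd; case: odd; case: b {e}.
exists (enum s) => e; set sw := enum s.
have -> : e = flips sw (flips (rev sw) e).
  rewrite /flips; elim: (sw) e => [//|v l IH] e /=.
  by rewrite rev_cons foldr_rcons -IH flip_atK.
rewrite mem_flips; move: (flips _ e) => {}e; rewrite inE => /andP[eG].
have /cards2P[u [w [uw eE]]] := forall_inP (edges_card2 G) _ eG.
have {}eE : e = ([set u; w], e.2) by case: (e) eE => ? ? /= ->.
move: eG; rewrite eE /=; move: (e.2) => b eG;
  rewrite finset.subUset !finset.sub1set => /andP[uB wB].
rewrite flipsE //= (sP _ _ _ eG uB wB) !count_uniq_mem ?enum_uniq //.
by rewrite !mem_enum !oddb -!topredE /=; case: (s u); case: (s w).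
Qed.

(** The edges of the open walk that leaves the successive vertices of [c] and
arrives at [y]. *)
Fixpoint steps (T : finType) (c : seq (T * bool)) (y : T) : seq (sedge T) :=
  if c is a :: c' then ([set a.1; (head (y, false) c').1], a.2) :: steps c' y
  else [::].

Lemma walk_edges_steps (T : finType) (c : seq (T * bool)) a :
  walk_edges (a :: c) = steps (a :: c) a.1.
Proof.
rewrite /walk_edges rot1_cons.
suff H (z : T * bool) : [seq ([set d.1.1; d.2.1], d.1.2)
    | d <- zip (a :: c) (rcons c z)] = steps (a :: c) z.1 by exact: H.
by elim: c a => [//|b c IH] a; congr (_ :: _); apply: IH.
Qed.

Lemma steps_cat (T : finType) (c1 c2 : seq (T * bool)) y :
  steps (c1 ++ c2) y = steps c1 (head (y, false) c2).1 ++ steps c2 y.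
Proof. by elim: c1 => [//|a [|b c1] IH] //; congr (_ :: _); apply: IH. Qed.

Definition step_sign (T : finType) (es : seq (sedge T)) : bool :=
  \big[addb/false]_(e <- es) e.2.

Lemma step_sign_cat (T : finType) (es1 es2 : seq (sedge T)) :
  step_sign (es1 ++ es2) = step_sign es1 (+) step_sign es2.
Proof. by rewrite /step_sign big_cat. Qed.

Lemma nuniq_split (A : Type) (B : eqType) (f : A -> B) (s : seq A) :
  ~~ uniq (map f s) -> exists s1 a s2 b s3,
    s = s1 ++ a :: s2 ++ b :: s3 /\ f a = f b.
Proof.
elim: s => [//|a s IH] /=; rewrite negb_and negbK => /orP[|/IH].
  move=> fs; suff [s2 [b [s3 [-> fE]]]] :
    exists s2 b s3, s = s2 ++ b :: s3 /\ f a = f b.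
    by exists [::], a, s2, b, s3.
  elim: s fs {IH} => [//|b s IH]; rewrite inE => /predU1P[fE|/IH].
    by exists [::], b, s.
  by move=> [s2 [c [s3 [-> fE]]]]; exists (b :: s2), c, s3.
by move=> [s1 [x [s2 [b [s3 [-> fE]]]]]]; exists (a :: s1), x, s2, b, s3.
Qed.

Lemma steps_ends (T : finType) (c : seq (T * bool)) y e z :
  e \in steps c y -> z \in e.1 -> z \in y :: map fst c.
Proof.
elim: c => [//|a c IH] /=; rewrite in_cons => /predU1P[->|ec] /=.
  rewrite !inE => /orP[->|]; first by rewrite orbT.
  case: c {IH} => [|b c] /=; rewrite ?inE; move=> -> //; by rewrite !orbT.
by move=> /(IH ec); rewrite !inE orbCA => ->; rewrite orbT.
Qed.

Lemma uniq_steps (T : finType) (c : seq (T * bool)) y :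
  uniq (y :: map fst c) -> uniq (steps c y).
Proof.
elim: c => [//|a c IH] /= /and3P[]; rewrite inE negb_or => /andP[ya yc] ac uc.
rewrite IH /= ?yc ?uc // andbT; apply/negP => /(steps_ends (z := a.1)).
by rewrite /= !inE eqxx [a.1 == y]eq_sym (negbTE ya) (negbTE ac) => /(_ isT).
Qed.

(** If a vertex is repeated, the closed walk splits at it into two shorter
closed walks, and the product of their signs is negative, so one of them is
negative. A closed walk without repeated vertices is a cycle, except that it
may have length 1, which loops would require, or traverse an edge back and
forth, which makes it positive. *)
Lemma neg_walk_cycle (T : finType) (G : sgraph T) a (c : seq (T * bool)) :
    {subset steps (a :: c) a.1 <= edges G} -> step_sign (steps (a :: c) a.1) ->
  exists c', [/\ is_cycle G c', cycle_sign c' & size c' <= (size c).+1].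
Proof.
have [n] := ubnP (size c); elim: n a c => [//|n IH] a c cn cG cs.
have [uc|/nuniq_split] := boolP (uniq (map fst (a :: c))).
  exists (a :: c); rewrite /is_cycle /cycle_sign walk_edges_steps; split=> //.
  rewrite uc; have -> : all (fun e => e \in edges G) (steps (a :: c) a.1).
    by apply/allP.
  rewrite andbT /=.
  case: c cn cG cs uc => [|b c] cn cG cs uc.
    by have := edge_neq (cG _ (mem_head _ _)); rewrite eqxx.
  rewrite -/(steps (b :: c) a.1) uniq_steps // andbT.
  case: c cn cG cs uc => [|d c] cn cG cs uc /=.
    rewrite !inE; apply/eqP => -[_ ab]; move: cs.
    by rewrite /step_sign !big_cons big_nil /= ab addbF addbb.
  move: uc => /=; rewrite !inE !negb_or =>
    /and3P[/and3P[ab ad ac] /andP[bd bc] _].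
  apply/andP; split.
    apply/eqP => -[/setP/(_ a.1)].
    by rewrite !inE eqxx (negbTE ab) (negbTE ad).
  suff: ([set a.1; b.1], a.2) \notin steps (d :: c) a.1.
    by rewrite /= in_cons negb_or.
  apply/negP => /(steps_ends (z := b.1)); rewrite /= !inE eqxx orbT => /(_ isT).
  by rewrite eq_sym (negbTE ab) (negbTE bd) (negbTE bc).
case=> s1 [[x p] [s2 [[x' q] [s3 [cE /= xE]]]]]; rewrite -{x'}xE in cE.
have ac : a.1 = (head (x, false) s1).1 by case: s1 cE => [|? ?] [->].
have sz : (size c).+1 = size s1 + (size s2).+1 + (size s3).+1.
  by rewrite -[LHS]/(size (a :: c)) cE size_cat /= size_cat /=; lia.
have wE : steps (a :: c) a.1 =
    steps s1 x ++ steps ((x, p) :: s2) x ++ steps ((x, q) :: s3) a.1.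
  by rewrite cE steps_cat -cat_cons steps_cat.
rewrite wE in cG cs.
have [ws|ws] := boolP (step_sign (steps ((x, p) :: s2) x)).
  have [|//|//|c' [c1 c2 c3]] := IH (x, p) s2; first by lia.
    by move=> e es; apply: cG; rewrite !mem_cat es orbT.
  by exists c'; split=> //; lia.
have [b [s sE]] : exists b s, b :: s = s1 ++ (x, q) :: s3.
  by case: (s1) => [|b s]; [exists (x, q), s3 | exists b, (s ++ (x, q) :: s3)].
have ba : b.1 = a.1 by rewrite ac; case: (s1) sE => [|? ?] [->].
have sE' : steps (b :: s) b.1 = steps s1 x ++ steps ((x, q) :: s3) a.1.
  by rewrite sE ba steps_cat.
have ss : (size s).+1 = size s1 + (size s3).+1.
  by rewrite -[LHS]/(size (b :: s)) sE size_cat.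
have [|||c' [c1 c2 c3]] := IH b s; first by lia.
- rewrite sE' => e; rewrite mem_cat => /orP[] es; apply: cG.
    by rewrite !mem_cat es.
  by rewrite !mem_cat es !orbT.
- by move: cs; rewrite sE' !step_sign_cat (negbTE ws).
by exists c'; split=> //; lia.
Qed.

(** * Balls and clustered sets *)

Definition adj (T : finType) (G : sgraph T) (u w : T) :=
  [exists b, ([set u; w], b) \in edges G].

Lemma adjC (T : finType) (G : sgraph T) : symmetric (adj G).
Proof. by move=> u w; apply: eq_existsb => b; rewrite finset.setUC. Qed.

Fixpoint graph_ball (T : finType) (G : sgraph T) (v : T) j : {set T} :=
  if j is j'.+1 then
    graph_ball G v j' :|: [set w | [exists u in graph_ball G v j', adj G u w]]
  else [set v].

Lemma graph_ball_adj (T : finType) (G : sgraph T) (v u w : T) j :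
  u \in graph_ball G v j -> adj G u w -> w \in graph_ball G v j.+1.
Proof.
by move=> uj uw; rewrite !inE; apply/orP; right; apply/existsP; exists u;
  rewrite uj.
Qed.

Lemma graph_ball_mono (T : finType) (G : sgraph T) (v : T) i j :
  i <= j -> graph_ball G v i \subset graph_ball G v j.
Proof.
move=> /subnK <-; elim: (j - i) => [//|m IH]; rewrite addSn.
exact: fintype.subset_trans IH (finset.subsetUl _ _).
Qed.

Lemma graph_ball_center (T : finType) (G : sgraph T) (v : T) j :
  v \in graph_ball G v j.
Proof.
by apply: (fintype.subsetP (graph_ball_mono G v (leq0n j))); rewrite finset.inE.
Qed.

(** The walk is provided in both directions, with the same sign. *)
Lemma graph_ball_walk (T : finType) (G : sgraph T) (v u : T) j :
  u \in graph_ball G v j ->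
  exists c c' : seq (T * bool),
    [/\ (head (u, false) c).1 = v /\ (head (v, false) c').1 = u,
        {subset steps c u <= edges G}, {subset steps c' v <= edges G},
        step_sign (steps c u) = step_sign (steps c' v)
      & size c <= j /\ size c' <= j].
Proof.
elim: j u => [|j IH] u.
  by rewrite inE => /eqP->; exists [::], [::].
rewrite !inE => /orP[/IH [c [c' [h s1 s2 s [z1 z2]]]]|].
  by exists c, c'; split=> //; split; lia.
case/existsP => w /andP[/IH [c [c' [[h h'] s1 s2 s [z1 z2]]]]] /existsP[b wu].
exists (rcons c (w, b)), ((u, b) :: c').
rewrite -cats1 steps_cat /= step_sign_cat /= h' size_cat /= addn1.
split.
- by split=> //; case: (c) h.
- by move=> e; rewrite mem_cat inE => /orP[/s1|/eqP->].
- by move=> e; rewrite inE => /orP[/eqP->|/s2//]; rewrite finset.setUC.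
- by rewrite s /step_sign !big_cons big_nil addbF addbC.
- by split.
Qed.

(** Every connected component of [X] lies in a ball of radius [r] of [G].
Instead of components, a center is attached to each vertex, and adjacent
vertices of [X] share their center. *)
Definition clustered (T : finType) (G : sgraph T) r (X : {set T}) : Prop :=
  exists ctr : T -> T, (forall u, u \in X -> u \in graph_ball G (ctr u) r) /\
    {in X &, forall u w, adj G u w -> ctr u = ctr w}.

(** Sign each vertex by a short walk from its center. An edge that disagrees
with the signs of its ends closes up, with their two walks, to a negative walk
of length at most [2 * r + 1]. *)
Lemma clustered_balanced (T : finType) (G : sgraph T) r (X : {set T}) :
    (forall c, is_cycle G c -> cycle_sign c -> (r + r).+1 < size c) ->
  clustered G r X -> balanced G X.
Proof.
move=> girth [ctr [ctrP adjP]]; apply/balancedP.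
have /boolp.choice[s sP] : forall u, exists b, u \in X ->
    exists c c' : seq (T * bool),
    [/\ (head (u, false) c).1 = ctr u /\ (head (ctr u, false) c').1 = u,
        {subset steps c u <= edges G}, {subset steps c' (ctr u) <= edges G},
        step_sign (steps c u) = b /\ step_sign (steps c' (ctr u)) = b
      & size c <= r /\ size c' <= r].
  move=> u; have [uX|uX] := boolP (u \in X); last by exists false.
  have [c [c' [h s1 s2 s z]]] := graph_ball_walk (ctrP _ uX).
  by exists (step_sign (steps c u)) => _; exists c, c'.
exists s => u w b e uX wX; apply/eqP; apply: contraT => nb.
have cE : ctr u = ctr w by apply: adjP => //; apply/existsP; exists b.
have [c [_ [[h _] cG _ [cs _] [cz _]]]] := sP u uX.
have [_ [c' [[_ h'] _ c'G [_ c's] [_ cz']]]] := sP w wX.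
rewrite -cE in h' c'G c's.
have [a [d dE]] : exists a d, a :: d = c ++ (u, b) :: c'.
  by case: (c) => [|a d]; [exists (u, b), c' | exists a, (d ++ (u, b) :: c')].
have av : a.1 = ctr u by rewrite -h; case: (c) dE => [|? ?] [->].
have wE : steps (a :: d) a.1 =
    steps c u ++ ([set u; w], b) :: steps c' (ctr u).
  by rewrite dE av steps_cat /= h'.
have dz : (size d).+1 = size c + (size c').+1.
  by rewrite -[LHS]/(size (a :: d)) dE size_cat.
have [||c0 [c1 c2 c3]] := @neg_walk_cycle T G a d.
- move=> x; rewrite wE mem_cat inE => /or3P[/cG//|/eqP->//|/c'G//].
- rewrite wE step_sign_cat cs /step_sign big_cons -/(step_sign _) c's /=.
  by move: nb; case: b {e dE wE}; case: (s u); case: (s w).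
by have := girth _ c1 c2; lia.
Qed.

Section Clustering.
Variables (T : finType) (G : sgraph T).

(** A connected set that leaves the ball of radius [r] around one of its
vertices has a vertex at each distance from [0] to [r + 1]. *)
Lemma thin_clustered r (X : {set T}) :
    (forall v, #|X :&: graph_ball G v r.+1| < r.+2) -> clustered G r X.
Proof.
move=> thin; pose e u w := [&& u \in X, w \in X & adj G u w].
have esym : connect_sym e.
  by apply: sym_connect_sym => u w; rewrite /e adjC andbCA.
exists (fingraph.root e); split; last first.
  move=> u w uX wX uw; apply/(fingraph.rootP esym)/connect1.
  by rewrite /e uX wX.
move=> u uX; set v := fingraph.root e u.
have vu : connect e v u by rewrite esym connect_root.
apply: contraT => nu.
have vX : v \in X.
  case/connectP: vu => -[_ uv|w p /= /andP[/and3P[//]]].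
  by rewrite /= in uv; rewrite -uv.
have grow j : u \notin graph_ball G v j ->
    exists2 w, w \in X &
      (w \in graph_ball G v j.+1) && (w \notin graph_ball G v j).
  move=> uj; have [/existsP[w /and3P[wX w1 w2]]|/existsPn nw] :=
    boolP [exists w, [&& w \in X, w \in graph_ball G v j.+1
      & w \notin graph_ball G v j]].
    by exists w; rewrite ?w1.
  have cl : fingraph.closed e (graph_ball G v j).
    apply: (intro_closed esym) => a b /and3P[aX bX ab] aj.
    have := nw b; rewrite bX (graph_ball_adj aj ab) /= negbK //.
  by move: uj; rewrite -(closed_connect cl vu) graph_ball_center.
have big j : j <= r.+1 -> j < #|X :&: graph_ball G v j|.
  elim: j => [_|j IH jr].
    by rewrite card_gt0; apply/set0Pn; exists v; rewrite !finset.inE vX eqxx.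
  have [w wX /andP[w1 w2]] : exists2 w, w \in X &
      (w \in graph_ball G v j.+1) && (w \notin graph_ball G v j).
    apply: grow; apply: contra nu; apply: fintype.subsetP;
      exact: graph_ball_mono.
  apply: leq_ltn_trans (IH (ltnW jr)) _; apply: proper_card.
  apply/properP; split; first by apply/finset.setIS/graph_ball_mono.
  by exists w; rewrite finset.in_setI wX ?w1.
by have := thin v; rewrite ltnNge big.
Qed.

(** Trade the part of [S] in the ball of radius [j + 1] for the vertices of
[X] at distance exactly [j + 1]: the ball of radius [j] becomes a cluster of
its own, cut off from the rest. *)
Lemma minimal_cut r (X S : {set T}) :
    S \subset X -> clustered G r (X :\: S) ->
    (forall S' : {set T}, S' \subset X -> clustered G r (X :\: S') ->
      #|S| <= #|S'|) ->
  forall v j, j <= r ->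
  #|S :&: graph_ball G v j.+1| + #|X :&: graph_ball G v j| <=
  #|X :&: graph_ball G v j.+1|.
Proof.
move=> SX [ctr [ctrP adjP]] Smin v j jr.
set B := graph_ball G v j.+1; set B' := graph_ball G v j.
have B'B : B' \subset B by apply: graph_ball_mono.
pose L := X :&: (B :\: B'); pose S' := (S :\: B) :|: L.
have S'X : S' \subset X.
  rewrite finset.subUset finset.subsetIl andbT.
  exact: fintype.subset_trans (finset.subsetDl _ _) SX.
have /(Smin _ S'X) : clustered G r (X :\: S').
  have out u : u \in X :\: S' -> u \notin B' -> u \in X :\: S /\ u \notin B.
    rewrite !finset.in_setD finset.in_setU !finset.in_setD finset.in_setI
      finset.in_setD.
    move=> /andP[+ uX] uB'; rewrite uX uB' /=.
    by case: (u \in B); case: (u \in S) => //= _; split.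
  exists (fun u => if u \in B' then v else ctr u); split.
    move=> u uX; case: ifP => [uB|/negbT uB].
      exact: (fintype.subsetP (graph_ball_mono G v jr)).
    by apply: ctrP; case: (out u uX uB).
  have step u w : u \in X :\: S' -> w \in X :\: S' -> adj G u w ->
      u \in B' -> w \notin B' -> false.
    by move=> uX wX uw uB /(out w wX)[_]; rewrite (graph_ball_adj uB uw).
  move=> u w uX wX uw; case: ifPn => uB; case: ifPn => wB //.
  - by have := step _ _ uX wX uw uB wB.
  - by rewrite adjC in uw; have := step _ _ wX uX uw wB uB.
  - by apply: adjP => //; [case: (out u uX uB) | case: (out w wX wB)].
have : #|S'| <= #|S :\: B| + #|L|.
  by rewrite cardsU leq_subr.
have := cardsID B S; have := cardsID B' (X :&: B).
have -> : X :&: B :&: B' = X :&: B'.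
  by rewrite -finset.setIA; congr (_ :&: _); apply/finset.setIidPr.
have -> : (X :&: B) :\: B' = L by rewrite /L finset.setIDA.
lia.
Qed.

(** Take a smallest [S] whose complement in [X] is clustered. By [minimal_cut],
a ball that is thick in [S] would make a larger ball too thick in [X]; so [S]
is thin, and the induction applies to it, the complement being the last class.
The bound on [i] and [t] keeps the radii within the range of [minimal_cut]. *)
Lemma cluster_partition t r i (X : {set T}) :
    i.+1 * t.+1 <= r.+1 ->
    (forall v, #|X :&: graph_ball G v (i.+1 * t.+1)| < t.+2 ^ i.+1) ->
  exists f : T -> 'I_i.+1, forall j, clustered G r [set u in X | f u == j].
Proof.
elim: i X => [|i IH] X ir thin.
  exists (fun=> ord0) => j.
  have -> : [set u in X | ord0 == j] = X.
    by apply/setP => u; rewrite inE (ord1 j) andbT.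
  have [ctr [cP aP]] : clustered G t X.
    by apply: thin_clustered => v; have := thin v; rewrite mul1n expn1.
  exists ctr; split=> // u uX; apply: fintype.subsetP (cP u uX);
    apply: graph_ball_mono; lia.
pose P (S : {set T}) := (S \subset X) && `[< clustered G r (X :\: S) >].
have PX : P X.
  rewrite /P subxx; apply/asboolP; exists id; split=> u;
    rewrite ?finset.setDv ?finset.inE //.
case: (arg_minnP (fun S : {set T} => #|S|) PX) => S /andP[SX /asboolP SC] Smin.
have cut := @minimal_cut r X S SX SC _.
have {}cut : forall v j, j <= r ->
    #|S :&: graph_ball G v j.+1| + #|X :&: graph_ball G v j| <=
    #|X :&: graph_ball G v j.+1|.
  by apply: cut => S' S'X S'C; apply: Smin; rewrite /P S'X; apply/asboolP.
(* If S were thick in the ball of radius a around v, then the ball and each of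
   the next t + 1 spheres around v would contain at least t.+2 ^ i.+1 vertices
   of X. *)
have [|v|f fP] := IH S; first by lia.
  rewrite ltnNge; apply/negP => thick.
  set a := i.+1 * t.+1 in thick.
  have grow m : m <= t.+1 ->
    m.+1 * t.+2 ^ i.+1 <= #|X :&: graph_ball G v (a + m)|.
    elim: m => [_|m IHm mt].
      by rewrite mul1n addn0 (leq_trans thick) // subset_leq_card //
        finset.setSI.
    rewrite addnS mulSn; apply: leq_trans (cut v (a + m) _);
      last by rewrite /a; lia.
    apply: leq_add; last by apply: IHm; lia.
    apply: leq_trans thick _; apply: subset_leq_card; apply: finset.setIS.
    by apply: graph_ball_mono; lia.
  have := thin v; rewrite ltnNge; apply/negP; rewrite negbK.
  rewrite expnS; have -> : i.+2 * t.+1 = a + t.+1 by rewrite /a; lia.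
  exact: grow.
exists (fun u => if u \in S then widen_ord (leqnSn _) (f u) else ord_max) => j.
have [->|jm] := eqVneq j ord_max.
  have -> // : [set u in X | (if u \in S then widen_ord (leqnSn _) (f u)
                  else ord_max) == ord_max] = X :\: S.
  apply/setP => u; rewrite !finset.inE andbC; congr (_ && _).
  by case: ifP => _; rewrite ?eqxx // -val_eqE /= ltn_eqF.
have ji : j < i.+1.
  have := ltn_ord j; rewrite ltnS leq_eqVlt => /predU1P[/= E|//].
  by case/eqP: jm; apply: val_inj.
have := fP (Ordinal ji).
have -> // : [set u in X | (if u \in S then widen_ord (leqnSn _) (f u)
                  else ord_max) == j] = [set u in S | f u == Ordinal ji].
apply/setP => u; rewrite !finset.inE.
have [uS|uS] := boolP (u \in S); first by rewrite (fintype.subsetP SX).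
by rewrite eq_sym (negbTE jm) andbF.
Qed.

(** The radius is [(k + 1) * (t + 1) - 1], so that negative cycles are longer
than twice the radius plus one. *)
Lemma girth_bcolorable t k :
    #|T| < t.+2 ^ k.+1 ->
    (forall c, is_cycle G c -> cycle_sign c -> k.+1 * t.+1 * 2 <= size c) ->
  bcolorable G k.+1.
Proof.
move=> nt girth; apply/asboolP.
have [||f fP] := @cluster_partition t (k.+1 * t.+1).-1 k [set: T]; first by lia.
  by move=> v; apply: leq_ltn_trans nt; exact: max_card.
exists f => i; apply: (@clustered_balanced _ _ (k.+1 * t.+1).-1).
  by move=> c c1 c2; have := girth c c1 c2; lia.
have := fP i; congr clustered; apply/setP => u; rewrite !finset.inE //.
Qed.

Lemma chi_b_le p : bcolorable G p -> chi_b G <= p.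
Proof. by rewrite /chi_b; case: ex_minnP => m _; apply. Qed.

Lemma neg_girth_le c : is_cycle G c -> cycle_sign c -> neg_girth G <= size c.
Proof.
move=> c1 c2; have hc : has_neg_cycle G (size c).
  by apply/existsP; exists (in_tuple c); rewrite c1.
by rewrite /neg_girth; case: pselect => [h|//]; case: ex_minnP => m _; apply.
Qed.

Lemma neg_girth_ge g :
    (exists2 c, is_cycle G c & cycle_sign c) ->
    (forall c, is_cycle G c -> cycle_sign c -> g <= size c) ->
  g <= neg_girth G.
Proof.
case=> c c1 c2 gc; rewrite /neg_girth; case: pselect => [h|[]].
  by case: ex_minnP => m /existsP[d /andP[d1 d2]] _; rewrite -(size_tuple d) gc.
by exists (size c); apply/existsP; exists (in_tuple c); rewrite c1.
Qed.

Lemma neg_girth_upper t k :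
  #|T| < t.+2 ^ k.+1 -> k.+1 < chi_b G -> neg_girth G <= k.+1 * t.+1 * 2.
Proof.
move=> nt kc; apply: contraLR kc; rewrite -!leqNgt -ltnNge => gt.
apply/chi_b_le/(girth_bcolorable nt) => c c1 c2.
exact: leq_trans (ltnW gt) (neg_girth_le c1 c2).
Qed.

(** A graph without negative cycles has arbitrarily large negative girth, so
the coloring theorem applies to it with a single color. *)
Lemma neg_cycle_exists : 1 < chi_b G -> exists2 c, is_cycle G c & cycle_sign c.
Proof.
move=> chi; apply: contrapT => nc; move: chi; apply/negP; rewrite -leqNgt.
apply/chi_b_le/(@girth_bcolorable #|T|); first by rewrite expn1.
by move=> c c1 c2; case: nc; exists c.
Qed.

End Clustering.

(** * The signed graph of the antipodal quotient *)

Section SphereGraph.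
Variables (g d n : nat).
Hypothesis g1 : 1 < g.

(** The lift of a vertex to the sphere on the sheet [b]. *)
Definition twist (b : bool) x := if b then antipode g x else x.

(** Vertices beyond the number of representatives are all placed at the pole
[0]; duplicates are harmless because points touch themselves. *)
Definition place (u : 'I_n.+1) := nth [:: 0] (sphere_reps g d) u.

Lemma place_sphere_reps u : place u \in sphere_reps g d.
Proof.
rewrite /place; case: (ltnP u (size (sphere_reps g d))) => [|us];
  first exact: mem_nth.
by rewrite nth_default //; case: (d) => *; exact: mem_head.
Qed.

Lemma place_sphere_point u : sphere_point g d (place u).
Proof. by rewrite /sphere_point place_sphere_reps. Qed.

Lemma sphere_point_twist b x : sphere_point g d x ->
  sphere_point g d (twist b x).
Proof. by case: b => //; apply: sphere_point_antipode. Qed.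

Lemma twist_twist b b' x : sphere_point g d x ->
  twist b (twist b' x) = twist (b (+) b') x.
Proof. by move=> /(antipode_sphere_pointK g1) xK; case: b; case: b'. Qed.

Lemma touching_twist b x y : touching x y -> touching (twist b x) (twist b y).
Proof. by case: b => //; apply: touching_antipode. Qed.

Lemma touching_twistC b x y : sphere_point g d x -> sphere_point g d y ->
  touching x (twist b y) = touching y (twist b x).
Proof.
move=> xs ys; apply/idP/idP => /(touching_twist b);
  by rewrite twist_twist // addbb touchingC.
Qed.

Definition sphere_edges : {set sedge 'I_n.+1} :=
  [set e | [exists u, exists v,
     [&& u != v, e.1 == [set u; v]
       & touching (place u) (twist e.2 (place v))]]].

Lemma sphere_card2 : [forall e in sphere_edges, #|e.1| == 2].
Proof.
apply/forall_inP => e;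
  rewrite inE => /existsP[u /existsP[v /and3P[uv /eqP-> _]]].
by rewrite cards2 uv.
Qed.

Definition sphere_graph : sgraph 'I_n.+1 := SGraph sphere_card2.

Lemma mem_sphere_edges u v b : ([set u; v], b) \in edges sphere_graph =
  (u != v) && touching (place u) (twist b (place v)).
Proof.
rewrite inE; apply/idP/idP => [|/andP[uv c]]; last first.
  by apply/existsP; exists u; apply/existsP; exists v; rewrite uv eqxx.
case/existsP => u' /existsP[v' /and3P[uv' /= /eqP E c]].
have := finset.set21 u v; have := finset.set22 u v; rewrite E !finset.inE.
have := finset.set21 u' v'; have := finset.set22 u' v'; rewrite -E !finset.inE.
do 2![case/orP => /eqP-?; subst => //].
all: try by rewrite eqxx in uv'.
all: move=> _ _; rewrite ?uv' ?c //.
by rewrite eq_sym uv' touching_twistC // place_sphere_point.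
Qed.

(** Walks lift to the sphere, and the sign of the walk tells on which sheet
the lift ends. *)
Lemma lift_walk (c : seq ('I_n.+1 * bool)) y :
    {subset steps c y <= edges sphere_graph} ->
  exists p, [/\ path touching (place (head (y, false) c).1) p, size p = size c,
    all (sphere_point g d) p
    & last (place (head (y, false) c).1) p =
      twist (step_sign (steps c y)) (place y)].
Proof.
elim: c => [|[x b] c IH] cG.
  by exists [::]; rewrite /step_sign /= big_nil.
have [|p [pp sp ap lp]] := IH.
  by move=> e ec; apply: cG; rewrite /= in_cons ec orbT.
have := cG _ (mem_head _ _); rewrite /= mem_sphere_edges => /andP[_ cl].
set z := (head _ c).1 in pp lp cl *.
exists (twist b (place z) :: map (twist b) p); split=> /=.
- rewrite cl path_map; apply: sub_path pp => ? ?; exact: touching_twist.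
- by rewrite size_map sp.
- rewrite sphere_point_twist ?place_sphere_point // all_map.
  by apply: sub_all ap => ?; exact: sphere_point_twist.
by rewrite last_map lp twist_twist ?place_sphere_point // /step_sign big_cons.
Qed.

Lemma sphere_girth c :
  is_cycle sphere_graph c -> cycle_sign c -> g <= size c.
Proof.
case: c => [//|a c] /and4P[_ _ _ /allP cG];
  rewrite /cycle_sign walk_edges_steps.
rewrite walk_edges_steps in cG; move=> cs.
have [p [pp <- ap lp]] := lift_walk cG.
apply: (touching_path_antipode (d := d) (x := place a.1) g1) => //=.
  by rewrite place_sphere_point.
by rewrite lp /= -/(steps (a :: c) a.1) /step_sign cs.
Qed.

Hypothesis enough : size (sphere_reps g d) <= n.+1.

(** The label of a representative is its color with its sign under a switching
that makes its color class positive; the other points get opposite labels.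
Touching points with opposite labels would be joined by an edge of the wrong
sign inside a color class. *)
Lemma sphere_chi q : bcolorable sphere_graph q -> d < q.
Proof.
move=> /asboolP[col colP].
have /boolp.choice[s sP] : forall i, exists s : 'I_n.+1 -> bool, forall u w b,
    ([set u; w], b) \in edges sphere_graph -> col u = i -> col w = i ->
    b = s u (+) s w.
  move=> i; have /balancedP[s sP] := colP i; exists s => u w b e ui wi.
  by apply: sP e _ _; rewrite finset.inE ?ui ?wi.
pose lab u := s (col u) u + (col u : nat).*2.
have lab_odd u : odd (lab u) = s (col u) u.
  by rewrite oddD odd_double addbF oddb.
have lab_half u : (lab u)./2 = col u.
  by rewrite /lab; case: (s _ _); rewrite /= ?add0n ?doubleK // uphalf_double.
pose idx x : 'I_n.+1 := inord (index x (sphere_reps g d)).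
have idxK x : x \in sphere_reps g d -> place (idx x) = x.
  move=> xr; rewrite /place inordK ?nth_index //.
  by apply: leq_trans enough; rewrite index_mem.
pose lam x := if last 1 x == 0 then lab (idx x)
  else opp_label (lab (idx (antipode g x))).
have lamT b r : r \in sphere_reps g d ->
    lam (twist b r) = if b then opp_label (lab (idx r)) else lab (idx r).
  move=> rr; rewrite /lam; case: b => /=; last by rewrite (sphere_reps_last rr).
  rewrite antipodeK ?(sphere_reps_le g1 rr) //.
  have -> // : (last 1 (antipode g r) == 0) = false.
  have := sphere_reps_last rr; case: (r) => [//|h l] /= lE.
  by rewrite last_map lE; lia.
have lamE x : sphere_point g d x ->
  exists b r, r \in sphere_reps g d /\ x = twist b r.
  by case/orP => [xr|/mapP[r rr ->]]; [exists false, x | exists true, r].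
have lab_neq u v b : touching (place u) (twist b (place v)) ->
    lab u <> (if b then lab v else opp_label (lab v)).
  move=> cl E.
  have cE : col u = col v.
    apply: val_inj => /=; rewrite -!lab_half E.
    by case: (b); rewrite ?half_opp_label.
  have oE : s (col u) u = b (+) ~~ s (col v) v.
    by rewrite -!lab_odd E; case: (b); rewrite ?odd_opp_label ?addTb ?negbK.
  have [uv|uv] := eqVneq u v.
    case: b cl E oE => [cl _ _|_ _]; last by rewrite uv; case: (s _ _).
    have := touching_path_antipode (d := d) (x := place u)
      (p := [:: antipode g (place u)]) g1.
    rewrite -uv in cl; rewrite /= cl place_sphere_point sphere_point_antipode
      ?place_sphere_point //=.
    by move=> /(_ isT isT erefl); lia.
  have e : ([set u; v], b) \in edges sphere_graph.
    by rewrite mem_sphere_edges uv.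
  have := sP _ _ _ _ e erefl (esym cE); rewrite oE -cE.
  by case: (b); case: (s _ _).
apply: (antipodal_labelling_size (g := g) g1 (lam := lam)); first split.
- move=> x /lamE[b [r [rr ->]]].
  have -> : antipode g (twist b r) = twist (~~ b) r.
    by case: b => //=; rewrite antipodeK // (sphere_reps_le g1 rr).
  by rewrite !lamT //; case: b; rewrite ?opp_labelK.
- move=> x y /lamE[b [r [rr ->]]] /lamE[b' [r' [rr' ->]]].
  rewrite !lamT // -(idxK r rr) -(idxK r' rr') => /(touching_twist b).
  rewrite !twist_twist ?place_sphere_point // addbb !idxK // -{1}(idxK r rr)
    -{1}(idxK r' rr').
  move/lab_neq; case: b; case: b' => /= H E; apply: H => //.
  - by rewrite -[LHS]opp_labelK E opp_labelK.
  - by rewrite -[LHS]opp_labelK E opp_labelK.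
  by rewrite E opp_labelK.
move=> x /lamE[b [r [rr ->]]]; rewrite lamT //.
by case: b; rewrite ?half_opp_label lab_half.
Qed.

End SphereGraph.

(** * Bounds on the maximal negative girth *)

Lemma lambda_s_ge g d n : 1 < g -> 0 < d -> d.+1 * g.-1 ^ d <= n ->
  g <= lambda_s n d.+1.
Proof.
move=> g1 d0 hn; have {}hn := leq_trans (size_sphere_reps d g1) hn.
case: n hn => [|n] hn; first by case: (d) hn.
have chi : d < chi_b (sphere_graph g d n).
  rewrite /chi_b; case: ex_minnP => q cq _; exact: sphere_chi hn _ cq.
apply: leq_trans (leq_bigmax_cond _ chi).
apply: neg_girth_ge; last by move=> c; exact: sphere_girth.
by apply: neg_cycle_exists; apply: leq_trans chi.
Qed.

Lemma lambda_s_le t k n : n < t.+2 ^ k.+1 -> lambda_s n k.+2 <= k.+1 * t.+1 * 2.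
Proof.
move=> nt; apply/bigmax_leqP => G; apply: neg_girth_upper; by rewrite card_ord.
Qed.

Import Order.TTheory GRing.Theory Num.Theory.
Import numFieldNormedType.Exports.

Section Bounds.
Local Open Scope ring_scope.
Variables (R : realType) (d n : nat).
Hypothesis d0 : (0 < d)%N.
Let x : R := n%:R `^ (d%:R^-1).

Lemma root_exp : x ^+ d = n%:R.
Proof.
by rewrite -powR_mulrn ?powR_ge0 // -powRrM mulVf ?pnatr_eq0 -?lt0n // powRr1.
Qed.

(** With [m] the integer part of [y = x / e], the sphere with [g = m + 1]
fits: [(d + 1) * m ^ d <= (e * y) ^ d = n]. When [y <= 2] the girth 2
suffices, and the corresponding sphere has [d + 1] representatives. *)
Lemma lambda_s_lower : (d < n)%N -> 1 / expR 1 * x <= (lambda_s n d.+1)%:R.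
Proof.
move=> dn; have e0 : 0 < expR 1 :> R := expR_gt0 _.
rewrite mul1r mulrC; set y := x / expR 1.
have y0 : 0 <= y by rewrite divr_ge0 ?powR_ge0 // ltW.
have [y2|y2] := leP y 2%:R.
  apply: le_trans y2 _; rewrite ler_nat; apply: lambda_s_ge => //.
  by rewrite exp1n muln1.
have [my ym] : (Num.trunc y)%:R <= y /\ y < (Num.trunc y).+1%:R.
  by have /andP[] := truncn_itv y0.
apply: le_trans (ltW ym) _; rewrite ler_nat; apply: lambda_s_ge => //.
  by rewrite -(ltr_nat R) (lt_trans _ ym) // (lt_trans _ y2) // ltr_nat.
rewrite /= -(ler_nat R) -root_exp natrM natrX.
have -> : x = expR 1 * y by rewrite mulrC divfK // gt_eqF.
rewrite exprMn; apply: ler_pM => //.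
- by rewrite -expRM_natl mulr1 -natr1 addrC expR_ge1Dx.
- by apply: lerXn2r => //; rewrite nnegrE.
Qed.

Lemma lambda_s_upper : (d < n)%N -> (lambda_s n d.+1)%:R <= 2 * d%:R * x.
Proof.
move=> dn; have x1 : 1 <= x.
  by rewrite -[leLHS](powRr0 n%:R) ler_powR ?invr_ge0 // ler1n; lia.
have x0 := le_trans ler01 x1.
have [tx xt] : (Num.trunc x)%:R <= x /\ x < (Num.trunc x).+1%:R.
  by have /andP[] := truncn_itv x0.
have t0 : (0 < Num.trunc x)%N by rewrite truncn_gt0.
case: (Num.trunc x) t0 tx xt => [//|t] _ tx xt;
  case: (d) d0 root_exp => [//|k] _ xk.
apply: (@le_trans _ _ (k.+1 * t.+1 * 2)%:R).
  rewrite ler_nat; apply: lambda_s_le.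
  by rewrite -(ltr_nat R) -xk natrX ltrXn2r.
by rewrite mulnC !natrM mulrA ler_wpM2l.
Qed.

End Bounds.

Unset Implicit Arguments.
Set Strict Implicit.
Set Printing Implicit Defensive.
Local Open Scope classical_set_scope.
Local Open Scope ring_scope.

Theorem theorem1p2 (R : realType) (p : nat) (hp : (2 <= p)%N) :
  ((fun n : nat => (lambda_s n p)%:R : R)
     \is 'Theta_\oo (fun n : nat => n%:R `^ (1 / (p%:R - 1)) : R)) /\
  (forall n : nat, (p <= n)%N ->
     1 / expR 1 * n%:R `^ (1 / (p%:R - 1)) <= (lambda_s n p)%:R :> R /\
     (lambda_s n p)%:R <= 2 * (p%:R - 1) * n%:R `^ (1 / (p%:R - 1)) :> R).
Proof.
case: p hp => [//|d] d0;
  have pE : d.+1%:R - 1 = d%:R :> R by rewrite -natr1 addrK.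
rewrite pE div1r.
have bounds n : (d < n)%N ->
    1 / expR 1 * n%:R `^ (d%:R^-1) <= (lambda_s n d.+1)%:R :> R /\
    (lambda_s n d.+1)%:R <= 2 * d%:R * n%:R `^ (d%:R^-1) :> R.
  by move=> dn; split; [exact: lambda_s_lower | exact: lambda_s_upper].
split=> //; rewrite qualifE /=; apply/asboolP.
exists (1 / expR 1, 2 * d%:R) => /=.
  by rewrite divr_gt0 ?expR_gt0 // mulr_gt0 // ltr0n.
near=> n; rewrite !ger0_norm ?powR_ge0 ?ler0n //.
apply: bounds; near: n; exact: nbhs_infty_gt.
Unshelve. all: by end_near.
Qed.
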